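(* Let $\mathcal{P}_1,\dots,\mathcal{P}_k\subseteq\mathbb{R}^n$ be polytopes, each with at least two vertices, and let $\mathcal{P} := \mathcal{P}_1\times\cdots\times\mathcal{P}_k$. Then the vertex-facet distance of $\mathcal{P}$ satisfies $$\mathsf{vf}_{\mathcal{P}} = \min_{1\le i\le k} \mathsf{vf}_{\mathcal{P}_i}.$$
   Context: A polytope is the convex hull of a finite set of points. For a polytope $\mathcal{P}$, $\mathcal{V}_{\mathcal{P}}$ is its set of vertices. A face of $\mathcal{P}$ is proper if it is neither $\emptyset$ nor $\mathcal{P}$; a facet is a maximal proper face (of dimension $\dim\mathcal{P}-1$), and $\mathsf{facets}(\mathcal{P})$ is the set of facets. $\mathrm{aff}(F)$ denotes the affine hull of $F$, $\|\cdot\|$ is the Euclidean norm, and $\mathsf{dist}(A,B)$ is the minimum of $\|x-y\|$ over $x\in A$, $y\in B$. For a polytope $\mathcal{P}$ with at least two vertices, the vertex-facet distance is $$\mathsf{vf}_{\mathcal{P}} := \min_{F\in\mathsf{facets}(\mathcal{P})} \mathsf{dist}\big(\mathrm{aff}(F),\ \mathcal{V}_{\mathcal{P}}\setminus F\big).$$ *)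

(* Defs.v *)
From HB Require Import structures.
From mathcomp Require Import all_boot all_order all_algebra.
From mathcomp Require Import all_classical all_reals all_analysis.

Set Implicit Arguments.
Unset Strict Implicit.
Unset Printing Implicit Defensive.

Import Order.TTheory GRing.Theory Num.Theory.

Local Open Scope classical_set_scope.
Local Open Scope ring_scope.

(* The least element of S; the junk value 0 is returned only when S has no
   least element. *)
Definition minimum (R : realType) (S : set R) : R :=
  xget 0 [set m | S m /\ lbound S m].

Lemma minimumE (R : realType) (S : set R) (m : R) :
  S m -> lbound S m -> minimum S = m.
Proof.
move=> Sm lbm; apply: xget_subset1 => // x y [Sx lbx] [Sy lby].
by apply/le_anti; rewrite lbx // lby.
Qed.

Definition dotp (R : realType) (n : nat) (a x : 'rV[R]_n) : R :=
  \sum_(j < n) a 0 j * x 0 j.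

(* The library norm on 'rV[R]_n is the sup norm, hence this definition. *)
Definition enorm (R : realType) (n : nat) (x : 'rV[R]_n) : R :=
  Num.sqrt (dotp x x).

Definition dist (R : realType) (n : nat) (A B : set 'rV[R]_n) : R :=
  minimum [set enorm (x - y) | x in A & y in B].

Definition convex_hull (R : realType) (n : nat) (A : set 'rV[R]_n) :
    set 'rV[R]_n :=
  smallest (@convex_set R 'rV[R]_n) A.

Definition affine_hull (R : realType) (n : nat) (A : set 'rV[R]_n) :
    set 'rV[R]_n :=
  [set x | exists (m : nat) (c : 'I_m -> R) (p : 'I_m -> 'rV[R]_n),
     [/\ forall i, A (p i), \sum_(i < m) c i = 1
       & x = \sum_(i < m) c i *: p i]].

Definition polytope (R : realType) (n : nat) (P : set 'rV[R]_n) : Prop :=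
  exists2 S : set 'rV[R]_n, finite_set S & P = convex_hull S.

(* The faces are the sets cut out by valid inequalities; a = 0 is allowed, so
   that set0 and P itself are faces. *)
Definition face (R : realType) (n : nat) (P F : set 'rV[R]_n) : Prop :=
  exists (a : 'rV[R]_n) (b : R),
    (forall x, P x -> dotp a x <= b) /\ F = P `&` [set x | dotp a x = b].

Definition proper_face (R : realType) (n : nat) (P F : set 'rV[R]_n) : Prop :=
  [/\ face P F, F <> set0 & F <> P].

Definition facets (R : realType) (n : nat) (P : set 'rV[R]_n) :
    set (set 'rV[R]_n) :=
  [set F | proper_face P F /\
           forall G, proper_face P G -> F `<=` G -> G = F].

Definition vertices (R : realType) (n : nat) (P : set 'rV[R]_n) :
    set 'rV[R]_n :=
  [set v | face P [set v]].

Definition vf (R : realType) (n : nat) (P : set 'rV[R]_n) : R :=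
  minimum [set dist (affine_hull F) (vertices P `\` F) | F in facets P].

(* (R^n)^k is identified with R^(k * n) by mxvec: the i-th block of n
   coordinates of x is row i (vec_mx x). *)
Definition product (R : realType) (k n : nat) (P : 'I_k -> set 'rV[R]_n) :
    set 'rV[R]_(k * n) :=
  [set x | forall i, P i (row i (vec_mx x))].

(* Main.v *)
Require Import Defs.
From HB Require Import structures.
From mathcomp Require Import all_boot all_order all_algebra.
From mathcomp Require Import finmap lra.
From mathcomp Require Import all_classical all_reals all_analysis.

Set Implicit Arguments.
Unset Strict Implicit.
Unset Printing Implicit Defensive.

Import Order.TTheory GRing.Theory Num.Theory.

Local Open Scope classical_set_scope.
Local Open Scope ring_scope.

(** A linear functional on a product splits into one functional per factor,
    and it is maximal at a point exactly when each of its parts is maximal at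
    the corresponding block.  Hence the nonempty faces of a product are the
    products of nonempty faces of the factors ([face_product],
    [face_productP]).  Two consequences follow: the vertices of the product are
    the points all of whose blocks are vertices ([vertices_productE]), and its
    facets are the cylinders obtained by replacing a single factor [P i] by one
    of its facets ([facets_product]).

    Take the cylinder over a facet [F] of [P i].  Its affine hull projects into
    that of [F], and a vertex of the product lies off the cylinder exactly when
    its [i]-th block lies off [F].  A distance in the product is at least the
    distance between the [i]-th blocks, and any pair consisting of a point of
    the affine hull of [F] and a vertex off [F] lifts to a pair which agrees in
    all the other blocks, so that its distance is unchanged.  The distances of
    the cylinder and of [F] therefore coincide ([dist_cylinder]).  So the
    facet distances of the product form the union, over [i], of those of
    [P i], and the minimum of the union is the minimum of the minima.

    As [minimum] takes a junk value on sets without a least element, two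
    minima are compared by showing that one set is contained in the other and
    bounds it from below elementwise: such sets have the same least elements,
    if any ([minimum_coinitial]).  Only one minimum has to be known to be
    attained, the one that defines [vf (P i)]: a polytope has finitely many
    faces, since each is the convex hull of the generators that it contains,
    and a polytope with two vertices has at least one facet, namely any maximal
    element of the finite nonempty set of its proper faces. *)

(** * Minima *)

(** Used for the order of the reals, to get a least element, and for reverse
    inclusion of faces, to get a facet. *)
Lemma finite_minimal (T : choiceType) (r : T -> T -> Prop) (A : set T) :
  (forall x, r x x) -> (forall y x z, r x y -> r y z -> r x z) ->
  finite_set A -> A !=set0 ->
  exists2 m, A m & forall x, A x -> r x m -> r m x.
Proof.
move=> rxx rtr /finite_seqP[s ->] {A}; elim: s => [[]//|x s IH _].
case: s => [|y s] in IH *.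
  exists x => /=; first by rewrite inE.
  by move=> z /=; rewrite inE => /eqP ->.
have [|m /= ms mP] := IH; first by exists y => /=; rewrite inE eqxx.
have [rxm|nrxm] := pselect (r x m).
- exists x => /=; first by rewrite inE eqxx.
  move=> z /=; rewrite inE => /orP[/eqP -> //|zs] rzx.
  by apply: (rtr m) => //; apply: mP => //; apply: (rtr x).
- exists m => /=; first by rewrite inE ms orbT.
  by move=> z /=; rewrite inE => /orP[/eqP -> /nrxm //|zs]; apply: mP.
Qed.

(** The two sets have the same least elements, so their minima agree even when
    neither is attained. *)
Lemma minimum_coinitial (R : realType) (A B : set R) :
  A `<=` B -> (forall y, B y -> exists2 x, A x & x <= y) ->
  minimum B = minimum A.
Proof.
move=> AB BA; rewrite /minimum; congr (xget _ _); apply/seteqP; split=> m /=.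
  move=> [Bm lbm]; have [x Ax xm] := BA _ Bm.
  suff -> : m = x by split=> // y /AB /lbm; apply: le_trans.
  by apply/le_anti; rewrite xm lbm//; apply: AB.
move=> [Am lbm]; split; first exact: AB.
by move=> y /BA[x Ax]; apply: le_trans; apply: lbm.
Qed.

Lemma finite_minimumP (R : realType) (A : set R) :
  finite_set A -> A !=set0 -> A (minimum A) /\ lbound A (minimum A).
Proof.
move=> finA A0.
have [||m Am mP] := @finite_minimal _ (fun x y : R => x <= y) _ _ _ finA A0.
- by move=> x.
- by move=> y x z; apply: le_trans.
have lbm : lbound A m.
  by move=> x Ax; have /orP[//|/(mP _ Ax)] := le_total m x.
by rewrite (minimumE Am lbm).
Qed.

(** * Faces of a polytope *)

Section Face.
Variables (R : realType) (n : nat).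
Implicit Types (a x y : 'rV[R]_n) (P S F : set 'rV[R]_n).

Lemma dotp_ge0 x : 0 <= dotp x x.
Proof. by apply: sumr_ge0 => j _; rewrite -expr2 sqr_ge0. Qed.

Lemma dotp_comb a x y (s t : R) :
  dotp a (s *: x + t *: y) = s * dotp a x + t * dotp a y.
Proof.
rewrite /dotp !mulr_sumr -big_split/=; apply: eq_bigr => j _.
by rewrite !mxE mulrDr !(mulrCA (a 0 j)).
Qed.

Lemma dotp0l x : dotp 0 x = 0.
Proof. by rewrite /dotp big1// => j _; rewrite mxE mul0r. Qed.

Lemma face_sub P F : face P F -> F `<=` P.
Proof. by move=> [a [b [_ ->]]] x []. Qed.

Lemma face_refl P : face P P.
Proof.
exists 0, 0; split=> [x _|]; first by rewrite dotp0l.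
by apply/seteqP; split=> [x Px|x []//]; split=> //=; rewrite dotp0l.
Qed.

Lemma convex_hull_gen S : S `<=` convex_hull S.
Proof. exact: sub_gen_smallest. Qed.

Lemma convex_hull_convex S x y (t : R) : 0 < t -> t < 1 ->
  convex_hull S x -> convex_hull S y ->
  convex_hull S (t *: x + (1 - t) *: y).
Proof.
move=> t0 t1 Sx Sy C [cC SC].
have t01 : Itv.spec (@Itv.num_sem R) (Itv.Real `[0%Z, 1%Z]) t.
  by apply/and3P; split; rewrite /= ?num_real// ?bnd_simp ltW.
have := cC x y (Itv.mk t01) (mem_set (Sx C (conj cC SC))).
by move=> /(_ (mem_set (Sy C (conj cC SC)))); rewrite inE.
Qed.

(** The points of the hull satisfying [Q] form a convex set that contains the
    generators. *)
Lemma convex_hull_ind S (Q : 'rV[R]_n -> Prop) :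
  (forall x, S x -> Q x) ->
  (forall x y (t : R), Q x -> Q y -> 0 < t -> t < 1 ->
     convex_hull S x -> convex_hull S y -> Q (t *: x + (1 - t) *: y)) ->
  forall x, convex_hull S x -> Q x.
Proof.
move=> SQ QQ x Sx.
suff : convex_hull S `<=` [set x | convex_hull S x /\ Q x].
  by move=> /(_ x Sx)[].
apply: smallest_sub; last first.
  by move=> y Sy; split; [exact: convex_hull_gen|exact: SQ].
apply/convex_setW => y z; rewrite !inE => -[Sy Qy] [Sz Qz] t t0 t1.
by apply: mem_set; split; [exact: convex_hull_convex|exact: QQ].
Qed.

(** If a point strictly between [x] and [y] attains the maximum [b] of a
    functional on the hull, then so do [x] and [y]; by induction on the hull,
    only generators lying on the face contribute to it. *)
Lemma face_convex_hull S F :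
  face (convex_hull S) F -> F = convex_hull (S `&` F).
Proof.
move=> [a [b [ab ->]]]; set F' := _ `&` [set _ | _]; apply/seteqP; split.
  suff H x : convex_hull S x -> dotp a x = b -> convex_hull (S `&` F') x.
    by move=> x [Sx axb]; apply: H.
  elim/convex_hull_ind=> {}x.
    move=> Sx axb; apply: convex_hull_gen; split=> //; split=> //.
    exact: convex_hull_gen.
  move=> y t Hx Hy t0 t1 Sx Sy; rewrite dotp_comb => e.
  have t1' : 0 < 1 - t by rewrite subr_gt0.
  have := ab _ Sx; have := ab _ Sy => yb xb.
  (* The convex combination of two values [<= b] is [b]. *)
  have [ex ey] : dotp a x = b /\ dotp a y = b by split; nra.
  by apply: convex_hull_convex => //; [exact: Hx|exact: Hy].
move=> x; elim/convex_hull_ind=> {}x; first by case.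
move=> y t [Sx /= ax] [Sy /= ay] t0 t1 _ _.
split; first exact: convex_hull_convex.
by rewrite /= dotp_comb ax ay -mulrDl addrC subrK mul1r.
Qed.

Lemma finite_faces P : polytope P -> finite_set (face P).
Proof.
move=> [S /finite_fsetP[X ->] ->].
apply: (@sub_finite_set _ _ ((fun Y : {fset 'rV[R]_n} => convex_hull [set` Y])
  @` [set` fpowerset X])); last exact: finite_image.
move=> F /face_convex_hull FE.
have finF : finite_set ([set` X] `&` F) by apply: finite_setIl.
exists (fset_set ([set` X] `&` F)); last by rewrite fset_setK.
rewrite /= fpowersetE; apply/fsubsetP => x.
by rewrite in_fset_set// inE => -[].
Qed.

Lemma finite_facets P : polytope P -> finite_set (facets P).
Proof.
by move=> /finite_faces; apply: sub_finite_set => F [[]].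
Qed.

(** The second vertex makes the vertex [u] a proper face; a maximal element of
    the finite set of proper faces is a facet. *)
Lemma facets_nonempty P u v :
  polytope P -> vertices P u -> vertices P v -> u <> v -> facets P !=set0.
Proof.
move=> Ppol uV vV uv.
have fin : finite_set (proper_face P).
  by apply: sub_finite_set (finite_faces Ppol) => F [].
have ne : proper_face P !=set0.
  exists [set u]; split=> //; first by move=> /seteqP[/(_ u erefl)].
  by move=> e; apply/uv/esym; have := face_sub vV; rewrite -e; apply.
have [F PF Fmax] : exists2 F, proper_face P F &
    forall G, proper_face P G -> F `<=` G -> G `<=` F.
  apply: (finite_minimal (r := fun A B => B `<=` A)) fin ne.
    by move=> B.
  by move=> B A C BA CB; apply: subset_trans BA.
by exists F; split=> // G PG FG; apply/seteqP; split=> //; apply: Fmax.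
Qed.

End Face.

(** * Faces of a product *)

Section Product.
Variables (R : realType) (k n : nat).
Implicit Types (P G : 'I_k -> set 'rV[R]_n) (x y : 'rV[R]_(k * n)).
Implicit Types (f : 'I_k -> 'rV[R]_n).

(** The sets [product P] unfold to conditions on [row i (vec_mx x)]; naming this
    map makes room for its linear structure. *)
Definition block (i : 'I_k) x : 'rV[R]_n := row i (vec_mx x).

Definition glue f : 'rV[R]_(k * n) := mxvec (\matrix_(i < k) f i).

Lemma blockK f i : block i (glue f) = f i.
Proof. by rewrite /block /glue mxvecK rowK. Qed.

Lemma block_inj x y : (forall i, block i x = block i y) -> x = y.
Proof. by move=> e; apply: (can_inj vec_mxK); apply/row_matrixP. Qed.

HB.instance Definition _ i := GRing.Linear.copy (block i) (row i \o vec_mx).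

Lemma dotp_block x y : dotp x y = \sum_i dotp (block i x) (block i y).
Proof.
rewrite /dotp (reindex _ (curry_mxvec_bij _ _)) /= pair_bigA /=.
by apply: eq_bigr => -[i j] _ /=; rewrite !mxE.
Qed.

Definition update y i (u : 'rV[R]_n) : 'rV[R]_(k * n) :=
  glue (fun j => if j == i then u else block j y).

Lemma block_update y i u j :
  block j (update y i u) = if j == i then u else block j y.
Proof. exact: blockK. Qed.

(** Nonemptiness of all the [G i] is what allows a point of one of them to be
    completed to a point of the product. *)
Lemma product_sub G P : (forall i, G i !=set0) ->
  product G `<=` product P -> forall i, G i `<=` P i.
Proof.
move=> /choice[f Gf] GP i u Gu.
have /GP /(_ i) : product G (glue (fun j => if j == i then u else f j)).
  by move=> j; rewrite -/(block _ _) blockK; case: eqP => [->|].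
by rewrite -/(block _ _) blockK eqxx.
Qed.

(** Sum the inequalities that define the [G i]: a sum of valid inequalities is
    tight only if each of them is. *)
Lemma face_product P G :
  (forall i, face (P i) (G i)) -> face (product P) (product G).
Proof.
move=> /choice[a /choice[b ab]].
have le_ab y i : product P y -> dotp (a i) (block i y) <= b i.
  by move=> Py; apply: (ab i).1; exact: Py.
have dotpE y : dotp (glue a) y = \sum_i dotp (a i) (block i y).
  by rewrite dotp_block; apply: eq_bigr => i _; rewrite blockK.
exists (glue a), (\sum_i b i); split.
  by move=> y Py; rewrite dotpE; apply: ler_sum => i _; exact: le_ab.
apply/seteqP; split=> y.
  move=> Gy; split=> [i|/=]; first by have := Gy i; rewrite (ab i).2 => -[].
  rewrite dotpE; apply: eq_bigr => i _.
  by have := Gy i; rewrite (ab i).2 => -[].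
move=> [Py /=]; rewrite dotpE => /eqP; rewrite eq_sym -subr_eq0 -sumrB => /eqP.
move=> /psumr_eq0P e i; rewrite (ab i).2; split; first exact: Py.
by apply/esym/subr0_eq/e => // j _; rewrite subr_ge0 le_ab.
Qed.

(** Fix a point [z] of the face.  Changing only the [i]-th block of [z] shows
    that the [i]-th part of the functional is maximal on [P i] at the [i]-th
    block of [z]; so the face consists of the points where every part takes the
    value that it takes at [z]. *)
Lemma face_productP P F : face (product P) F -> F !=set0 ->
  exists2 G, (forall i, face (P i) (G i)) & F = product G.
Proof.
move=> [a [b [ab ->]]] [z [Pz /= zb]].
have le_az i u : P i u -> dotp (block i a) u <= dotp (block i a) (block i z).
  move=> Pu; have /ab : product P (update z i u).
    move=> j; rewrite -/(block _ _) block_update.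
    by case: eqP => [->//|_]; exact: Pz.
  rewrite -zb !dotp_block (bigD1 i)//= [leRHS](bigD1 i)//= block_update eqxx.
  rewrite (eq_bigr (fun j => dotp (block j a) (block j z))) ?lerD2r// => j ji.
  by rewrite block_update (negbTE ji).
exists (fun i => P i `&`
    [set u | dotp (block i a) u = dotp (block i a) (block i z)]).
  move=> i; exists (block i a), (dotp (block i a) (block i z)).
  by split=> // u /le_az.
apply/seteqP; split=> y; last first.
  move=> Gy; split=> [i|/=]; first by have [] := Gy i.
  by rewrite -zb !dotp_block; apply: eq_bigr => i _; have [] := Gy i.
move=> [Py /= yb] i; split; first exact: Py.
have := yb; rewrite -zb !dotp_block => /eqP.
rewrite eq_sym -subr_eq0 -sumrB => /eqP /psumr_eq0P e.
apply/esym/subr0_eq/e => // j _; rewrite subr_ge0.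
by apply: le_az; exact: Py.
Qed.

(** A singleton is the product of the singletons of its blocks. *)
Lemma vertices_productE P x :
  vertices (product P) x <-> forall i, vertices (P i) (block i x).
Proof.
have xE : [set x] = product (fun i => [set block i x]).
  by apply/seteqP; split=> [_ ->//|y xy]; apply: block_inj => i; exact: xy.
split=> [xV i|xV]; last by rewrite /vertices /= xE; exact: face_product.
have [|G fG GE] := face_productP xV; first by exists x.
rewrite /vertices /= -(_ : G i = [set block i x])//; apply/seteqP.
have Gx : product G x by rewrite -GE.
split=> [u Gu|_ ->]; last exact: Gx.
have : product G (update x i u).
  move=> j; rewrite -/(block _ _) block_update.
  by case: eqP => [->//|_]; exact: Gx.
by rewrite -GE => <-; rewrite block_update eqxx.
Qed.

(** * Cylinders over a subset of one factor *)

Definition cylinder P i (A : set 'rV[R]_n) : set 'rV[R]_(k * n) :=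
  product (fun j => if j == i then A else P j).

Lemma cylinder_update P i (A : set 'rV[R]_n) y u :
  product P y -> A u -> cylinder P i A (update y i u).
Proof.
move=> Py Au j; rewrite -/(block _ _) block_update.
by case: eqP => [//|_]; exact: Py.
Qed.

Lemma cylinder_block P i (A : set 'rV[R]_n) x :
  cylinder P i A x -> A (block i x).
Proof. by move=> /(_ i); rewrite eqxx. Qed.

Lemma cylinder_of_block P i (A : set 'rV[R]_n) x :
  product P x -> A (block i x) -> cylinder P i A x.
Proof. by move=> Px Ax j; case: eqP => [->//|_]; exact: Px. Qed.

Lemma cylinder_sub P i (A B : set 'rV[R]_n) : (forall j, P j !=set0) ->
  A `<=` B <-> cylinder P i A `<=` cylinder P i B.
Proof.
move=> /choice[f Pf]; split=> [AB x Ax j|AB u Au].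
  by have := Ax j; case: eqP => // _; apply: AB.
have := AB _ (cylinder_update i (y := glue f) _ Au).
move=> /(_ _)/cylinder_block; rewrite block_update eqxx; apply=> j.
by rewrite -/(block _ _) blockK.
Qed.

Lemma proper_face_cylinder P i (A : set 'rV[R]_n) : (forall j, P j !=set0) ->
  proper_face (P i) A -> proper_face (product P) (cylinder P i A).
Proof.
move=> P0 [fA A0 AP]; have [f Pf] := choice P0; split.
- by apply: face_product => j; case: eqP => [->//|_]; exact: face_refl.
- move/eqP/set0P: A0 => [u Au].
  apply/eqP/set0P; exists (update (glue f) i u); apply: cylinder_update Au.
  by move=> j; rewrite -/(block _ _) blockK.
- move=> e; apply: AP; apply/seteqP; split; first exact: face_sub.
  have : product P `<=` cylinder P i A by rewrite e.
  by move=> /(product_sub P0)/(_ i); rewrite eqxx.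
Qed.

(** A proper face has a factor [G i] different from [P i], so it is contained
    in the cylinder over [G i], which is still a proper face: a maximal proper
    face is therefore such a cylinder.  Conversely, a face containing the
    cylinder over a facet [A] has all its other factors full, and its [i]-th
    factor lies between [A] and [P i]. *)
Lemma facets_product P F : (forall i, P i !=set0) ->
  facets (product P) F <->
  exists i, exists2 A, facets (P i) A & F = cylinder P i A.
Proof.
move=> P0; split.
  move=> [[fF /eqP/set0P F0 FP] Fmax].
  have [G fG FE] := face_productP fF F0.
  have [i GPi] : exists i, G i <> P i.
    by apply/existsNP => GP; apply: FP; rewrite FE; congr product; apply/funext.
  have Gpr : proper_face (P i) (G i).
    split=> //; case: F0 => x; rewrite FE => /(_ i) Gx; apply/eqP/set0P.
    by exists (row i (vec_mx x)).
  have FC : cylinder P i (G i) = F.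
    apply: Fmax; first exact: proper_face_cylinder.
    rewrite FE => x Gx j; case: eqP => [->|_]; first exact: Gx.
    by apply: (face_sub (fG j)); exact: Gx.
  exists i, (G i) => //; split=> // B prB GB; apply/seteqP; split=> //.
  apply/(cylinder_sub i _ _ P0); rewrite FC.
  rewrite (Fmax _ (proper_face_cylinder P0 prB))// -FC.
  exact/cylinder_sub.
move=> [i [A [prA Amax] ->]]; split; first exact: proper_face_cylinder.
move=> H [fH /eqP/set0P H0 HP] AH; have [G fG HE] := face_productP fH H0.
have AP0 j : (if j == i then A else P j) !=set0.
  by case: eqP => // _; case: prA => _ /eqP/set0P.
have PG j : (if j == i then A else P j) `<=` G j.
  by move: AH; rewrite HE => /(product_sub AP0); exact.
have GP j : j <> i -> G j = P j.
  move=> /eqP/negbTE ji; apply/seteqP; split; first exact: face_sub.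
  by have := PG j; rewrite ji.
have GA : G i = A.
  apply: Amax; last by have := PG i; rewrite eqxx.
  split=> //.
    have := PG i; have := AP0 i; rewrite eqxx => -[u Au] /(_ u Au) Gu.
    by apply/eqP/set0P; exists u.
  move=> e; apply: HP; rewrite HE; congr product; apply/funext => j.
  by have [->//|/eqP/GP] := eqVneq j i.
rewrite HE; congr product; apply/funext => j.
by have [->//|/eqP/GP] := eqVneq j i.
Qed.

(** * Distances in a product *)

Lemma affine_hull_cylinder_block P i (A : set 'rV[R]_n) x :
  affine_hull (cylinder P i A) x -> affine_hull A (block i x).
Proof.
move=> [m [c [p [Ap c1 ->]]]]; exists m, c, (block i \o p); split=> //.
  by move=> l; apply: cylinder_block (Ap l).
by rewrite linear_sum; apply: eq_bigr => l _; rewrite linearZ.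
Qed.

(** An affine combination of points with a common [j]-th block keeps that
    block, because the coefficients sum to one. *)
Lemma affine_hull_cylinder_update P i (A : set 'rV[R]_n) y u :
  product P y -> affine_hull A u ->
  affine_hull (cylinder P i A) (update y i u).
Proof.
move=> Py [m [c [p [Ap c1 ->]]]]; exists m, c, (fun l => update y i (p l)).
split=> //; first by move=> l; exact: cylinder_update.
apply: block_inj => j; rewrite block_update linear_sum.
case: eqP => [->|/eqP/negbTE ji].
  by apply: eq_bigr => l _; rewrite linearZ /= block_update eqxx.
rewrite (eq_bigr (fun l => c l *: block j y)).
  by rewrite -scaler_suml c1 scale1r.
by move=> l _; rewrite linearZ /= block_update ji.
Qed.

(** The distances for [A] occur among those for the cylinder, by completing
    both points with the same vertices of the other factors; and dropping the
    other blocks can only decrease a distance. *)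
Lemma dist_cylinder P i (A : set 'rV[R]_n) :
  (forall j, vertices (P j) !=set0) ->
  dist (affine_hull (cylinder P i A)) (vertices (product P) `\` cylinder P i A)
  = dist (affine_hull A) (vertices (P i) `\` A).
Proof.
move=> /choice[f fV]; apply: minimum_coinitial.
  move=> _ [u uA] [v [vV nAv] <-].
  pose y := update (glue f) i v.
  have yV : vertices (product P) y.
    apply/vertices_productE => j.
    by rewrite block_update blockK; case: eqP => [->|].
  have Py : product P y by apply: (face_sub yV).
  exists (update y i u); first exact: affine_hull_cylinder_update.
  exists y.
    by split=> // /cylinder_block; rewrite block_update eqxx.
  rewrite /enorm dotp_block (bigD1 i)//= big1 ?addr0.
    by rewrite linearB /= !block_update eqxx.
  move=> j /negbTE ji; rewrite linearB /= !block_update ji subrr.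
  exact: dotp0l.
move=> _ [x xA] [y [yV nAy] <-].
have Py : product P y by apply: (face_sub yV).
exists (enorm (block i x - block i y)).
  exists (block i x); first exact: affine_hull_cylinder_block xA.
  exists (block i y) => //; split; first exact: (vertices_productE P y).1.
  by move=> Ay; apply: nAy; exact: cylinder_of_block.
rewrite -linearB /enorm ler_wsqrtr// [leRHS]dotp_block (bigD1 i)//= lerDl.
by apply: sumr_ge0 => j _; exact: dotp_ge0.
Qed.

End Product.

Theorem proposition4p7 (R : realType) (n k : nat) (P : 'I_k -> set 'rV[R]_n) :
  (0 < k)%N ->
  (forall i, polytope (P i)) ->
  (forall i, exists u v, [/\ vertices (P i) u, vertices (P i) v & u <> v]) ->
  vf (product P) = minimum [set vf (P i) | i in [set: 'I_k]].
Proof.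
move=> _ Ppol PV.
have V0 i : vertices (P i) !=set0 by have [u [_ [uV _ _]]] := PV i; exists u.
have P0 i : P i !=set0 by have [u uV] := V0 i; exists u; apply: (face_sub uV).
have vfP i :
    let D := [set dist (affine_hull F) (vertices (P i) `\` F)
             | F in facets (P i)] in
    D (vf (P i)) /\ lbound D (vf (P i)).
  have [u [v [uV vV uv]]] := PV i; apply: finite_minimumP.
    exact/finite_image/finite_facets.
  have [F FP] := facets_nonempty (Ppol i) uV vV uv.
  by exists (dist (affine_hull F) (vertices (P i) `\` F)); exists F.
apply: minimum_coinitial.
  (* The minimum of each [P i] is one of the facet distances of the product. *)
  move=> _ [i _ <-]; have [[F FP <-] _] := vfP i.
  exists (cylinder P i F); last exact: dist_cylinder.
  by apply/facets_product => //; exists i, F.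
move=> _ [_ /(facets_product _ P0)[i [F FP ->]] <-].
exists (vf (P i)); first by exists i.
by rewrite dist_cylinder//; apply: (vfP i).2; exists F.
Qed.
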